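(* For every $r=4t\ge48$ there exists a binary linear $[n,n-r,3]_2 4,2$ code with $n=2944\cdot2^{t-10}-3$. Consequently $\ell_2(4t,4)\le 2944\cdot 2^{t-10}-3$ for all $t\ge12$.
   Context: An $[n,n-r,d]_2R,\ell$ code is a binary linear code of length $n$, codimension $r$, minimum distance $d$, covering radius $R$ (smallest $R$ such that every vector of $\mathbb{F}_2^r$ is a sum of at most $R$ columns of a parity-check matrix $H$), such that some parity-check matrix $H$ admits an $(R,\ell)$-partition: a partition of its columns into nonempty subsets such that every vector of $\mathbb{F}_2^r$ (including zero) is the sum of at least $\ell$ and at most $R$ columns lying in pairwise distinct subsets. $\ell_2(r,R)$ is the smallest length of a binary linear code of codimension $r$ and covering radius $R$. *)

(* Defs.v *)
From HB Require Import structures.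
From mathcomp Require Import all_boot all_order all_algebra.
From Stdlib Require Import ClassicalEpsilon.
Set Implicit Arguments. Unset Strict Implicit. Unset Printing Implicit Defensive.
Import GRing.Theory.
Local Open Scope ring_scope.

Definition colsum (r n : nat) (H : 'M['F_2]_(r, n)) (S : {set 'I_n}) : 'cV['F_2]_r :=
  \sum_(j in S) col j H.

Definition wt (n : nat) (x : 'rV['F_2]_n) : nat := #|[set j | x 0 j != 0]|.

Definition min_dist (r n : nat) (H : 'M['F_2]_(r, n)) (d : nat) : Prop :=
  (exists x : 'rV['F_2]_n, [/\ x != 0, H *m x^T = 0 & wt x = d]) /\
  (forall x : 'rV['F_2]_n, x != 0 -> H *m x^T = 0 -> (d <= wt x)%N).

Definition covers (r n : nat) (H : 'M['F_2]_(r, n)) (R : nat) : Prop :=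
  forall v : 'cV['F_2]_r, exists S : {set 'I_n}, (#|S| <= R)%N /\ colsum H S = v.

Definition cov_radius (r n : nat) (H : 'M['F_2]_(r, n)) (R : nat) : Prop :=
  covers H R /\ forall R', covers H R' -> (R <= R')%N.

Definition RL_partition (r n : nat) (H : 'M['F_2]_(r, n)) (R l : nat)
    (P : {set {set 'I_n}}) : Prop :=
  partition P [set: 'I_n] /\
  forall v : 'cV['F_2]_r, exists S : {set 'I_n},
    [/\ (l <= #|S| <= R)%N,
        (forall B, B \in P -> (#|S :&: B| <= 1)%N)
      & colsum H S = v].

Definition is_code_RL (r n : nat) (H : 'M['F_2]_(r, n)) (d R l : nat) : Prop :=
  [/\ \rank H = r, min_dist H d, cov_radius H R & exists P, RL_partition H R l P].

Definition has_code (n r R : nat) : Prop :=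
  exists H : 'M['F_2]_(r, n), \rank H = r /\ cov_radius H R.

Definition has_codeb (r R : nat) (n : nat) : bool :=
  if excluded_middle_informative (has_code n r R) then true else false.

(* l_2(r,R): smallest length of a binary linear code of codimension r and
   covering radius R (set to 0 if no such code exists; irrelevant here). *)
Definition ell2 (r R : nat) : nat :=
  match excluded_middle_informative (exists n, has_codeb r R n) with
  | left h => ex_minn h
  | right _ => 0%N
  end.

(* Main.v *)
(** Over [F = F_(2^m)], [m = t - 5 >= 7], attach to each of 91 base points
    [p] of [F_2^20] its own node [b] in [F] and put into the parity-check matrix
    the columns [(p, z, zb, zb^2, zb^3)], [z] in [F].  If [u] in [F_2^20] is the
    sum of four distinct base points, then every [(u, x)] is a sum of four
    columns, because the corresponding Vandermonde system is solvable for every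
    [x].  So it suffices that sums of four distinct base points fill [F_2^20].

    The base points come from the same construction one level down: 72 of them
    lift the nine columns of the parity-check matrix of the perfect repetition
    code of length 9 to [F_8], with the nine points of the twisted cubic as
    nodes, and 19 further points lie over the zero syndrome.  That their sums
    of four fill [F_2^20] is checked by computation.

    The resulting columns number at most [91 * 2^m], and any column is the sum
    of three others with the same base point, so the trivial partition already
    is a (4,2)-partition.  Adding columns preserves everything, hence the
    prescribed length [92 * 2^m - 3] is reached by padding. *)

Require Import Defs.
From mathcomp Require Import all_boot all_order all_algebra all_field.
From mathcomp Require Import zify.
Set Implicit Arguments. Unset Strict Implicit. Unset Printing Implicit Defensive.
Import GRing.Theory.
Local Open Scope ring_scope.

(** * Codes from sets of columns *)

Lemma addmx2 m n (A : 'M['F_2]_(m, n)) : A + A = 0.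
Proof. by apply/matrixP=> i j; rewrite !mxE addrr_pchar2 ?pchar_Fp. Qed.

Lemma row_F2_neq0 n (x : 'rV['F_2]_n) j : x 0 j = (x 0 j != 0)%:R.
Proof. by case: (x 0 j) => [] [|[|]] // i; apply: val_inj. Qed.

(** Over F_2 zero terms drop out and equal terms cancel in pairs, so only an upper bound on the
    number of terms survives. *)
Lemma set_sum_of_seq r (A : {set 'cV['F_2]_r}) (s : seq 'cV['F_2]_r) :
  {subset s <= 0 |: A} -> exists X : {set 'cV['F_2]_r},
    [/\ X \subset A, (#|X| <= size s)%N & \sum_(x in X) x = \sum_(x <- s) x].
Proof.
elim: s => [_|a s IHs sA].
  by exists set0; rewrite sub0set cards0 big_set0 big_nil.
have [x xs|X [XA Xs defX]] := IHs; first by apply: sA; rewrite inE xs orbT.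
have := sA a (mem_head _ _); rewrite big_cons -defX 2!inE.
have [-> _|a0 /= aA] := eqVneq a 0.
  by exists X; rewrite add0r; split=> //; apply: leqW.
have [aX|aX] := boolP (a \in X).
  exists (X :\ a); split.
  - exact: subset_trans (subsetDl _ _) XA.
  - by apply: leq_trans (subset_leq_card (subsetDl _ _)) (leqW Xs).
  - by rewrite (big_setD1 a aX) /= addrA addmx2 add0r.
exists (a |: X); split.
- by rewrite subUset sub1set aA.
- by rewrite cardsU1 aX add1n ltnS.
- by rewrite big_setU1.
Qed.

Lemma superset_of_card (T : finType) (A B : {set T}) n :
  A \subset B -> (#|A| <= n <= #|B|)%N ->
  exists C : {set T}, [/\ A \subset C, C \subset B & #|C| = n].
Proof.
move=> AB /andP[An nB]; pose D := [set x in take (n - #|A|) (enum (B :\: A))].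
have DBA : D \subset B :\: A.
  by apply/subsetP=> x; rewrite inE => /mem_take; rewrite mem_enum.
exists (A :|: D); split; first exact: subsetUl.
  by rewrite subUset AB (subset_trans DBA) // subsetDl.
have AD : A :&: D = set0.
  apply/setP=> x; rewrite !inE; apply/negP=> /andP[xA xD].
  by have := subsetP DBA x; rewrite !inE xD xA => /(_ isT).
rewrite cardsU AD cards0 subn0 cardsE (card_uniqP _) ?take_uniq ?enum_uniq //.
rewrite size_takel ?subnKC // -cardE cardsD (setIidPr AB); exact: leq_sub2r.
Qed.

(** Counting: three slots, each empty or holding one column, yield at most [n.+1 ^ 3] sums, too few
    for [2 ^ r] vectors. *)
Lemma cov_radius_ge4 r n (H : 'M['F_2]_(r, n)) R :
  (n.+1 ^ 3 < 2 ^ r)%N -> covers H R -> (4 <= R)%N.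
Proof.
move=> n_lt covH; rewrite leqNgt; apply/negP; rewrite ltnS => R3.
pose f (g : {ffun 'I_3 -> option 'I_n}) : 'cV['F_2]_r :=
  \sum_k oapp (fun j => col j H) 0 (g k).
have f_onto v : v \in codom f.
  have [S [SR <-]] := covH v; apply/codomP.
  exists [ffun k : 'I_3 => onth (enum S) k]; rewrite /f /colsum -big_enum /=.
  under [RHS]eq_bigr => k _ do rewrite ffunE.
  have: (size (enum S) <= 3)%N by rewrite -cardE; apply: leq_trans R3.
  rewrite !big_ord_recr big_ord0 /=.
  case: (enum S) => [|a [|b [|c [|]]]] //= _; rewrite ?big_cons big_nil /=;
    by rewrite !(add0r, addr0) ?addrA.
have: (#|'cV['F_2]_r| <= #|{ffun 'I_3 -> option 'I_n}|)%N.
  rewrite -(size_codom f) cardT; apply: uniq_leq_size (enum_uniq _) _ => v _.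
  exact: f_onto.
by rewrite card_mx muln1 card_ffun card_option !card_ord leqNgt n_lt.
Qed.

Section SetCode.

Variables (r : nat) (A : {set 'cV['F_2]_r}).

Definition set_pcm : 'M['F_2]_(r, #|A|) :=
  \matrix_(i, j) (enum_val j : 'cV_r) i 0.

Lemma col_set_pcm j : col j set_pcm = enum_val j.
Proof. by apply/matrixP=> i k; rewrite !mxE ord1. Qed.

Lemma set_pcm_subset (X : {set 'cV['F_2]_r}) : X \subset A ->
  exists S : {set 'I_#|A|}, #|S| = #|X| /\ colsum set_pcm S = \sum_(x in X) x.
Proof.
move=> XA; pose S := [set j : 'I_#|A| | enum_val j \in X].
have defX : X = [set enum_val j | j in S].
  apply/setP=> x; apply/idP/imsetP=> [xX|[j]]; last by rewrite inE => ? ->.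
  have xA := subsetP XA x xX; exists (enum_rank_in xA x); last first.
    by rewrite enum_rankK_in.
  by rewrite inE enum_rankK_in.
exists S; rewrite defX card_imset ?big_imset /=; try exact: enum_val_inj.
  by split=> //; apply: eq_bigr => j _; rewrite col_set_pcm.
by move=> ? ? _ _; apply: enum_val_inj.
Qed.

Lemma mul_set_pcm (x : 'rV_#|A|) :
  set_pcm *m x^T = colsum set_pcm [set j | x 0 j != 0].
Proof.
rewrite /colsum big_mkcond; apply/matrixP=> i k; rewrite ord1 summxE [LHS]mxE.
apply: eq_bigr => j _; rewrite inE [x^T j 0]mxE {1}row_F2_neq0.
by case: (x 0 j != 0); rewrite !mxE ?mulr1 ?mulr0.
Qed.

(** Distinct nonzero columns exclude words of weight 1 and 2; the zero-sum triple supplies one of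
    weight 3. *)
Lemma min_dist_set_pcm (X : {set 'cV['F_2]_r}) : 0 \notin A ->
  X \subset A -> #|X| = 3%N -> \sum_(x in X) x = 0 -> min_dist set_pcm 3.
Proof.
move=> A0 XA X3 sumX; split.
  have [S [S3 sumS]] := set_pcm_subset XA.
  have defS : [set j | (\row_i (i \in S)%:R : 'rV['F_2]_#|A|) 0 j != 0] = S.
    by apply/setP=> j; rewrite inE mxE; case: (j \in S); rewrite ?oner_eq0 ?eqxx.
  exists (\row_i (i \in S)%:R); rewrite mul_set_pcm /wt defS sumS S3 X3; split=> //.
  apply/eqP=> /rowP x0; move: defS => /setP.
  have /card_gt0P[j jS] : (0 < #|S|)%N by rewrite S3 X3.
  by move/(_ j); rewrite jS inE x0 mxE eqxx.
move=> x x0; rewrite mul_set_pcm /wt => sumS.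
rewrite ltnNge leq_eqVlt; apply/negP=> /predU1P[]; last rewrite leq_eqVlt.
  case=> /eqP/cards2P[i [j [ij defS]]]; move: sumS; rewrite /colsum defS.
  rewrite big_setU1 ?inE //= big_set1 !col_set_pcm => /eqP.
  rewrite addr_eq0 => /eqP eq_ij; case/eqP: ij; apply: enum_val_inj.
  by rewrite eq_ij; apply/eqP; rewrite eq_sym -addr_eq0 addmx2.
case/predU1P=> [[]/eqP/cards1P[j defS]|]; last first.
  rewrite !ltnS leqn0 cards_eq0 => /eqP/setP S0; case/eqP: x0.
  apply/rowP=> j; have := S0 j; rewrite !inE mxE => /negbFE/eqP; exact.
move: sumS; rewrite /colsum defS big_set1 col_set_pcm => j0.
by case/negP: A0; rewrite -j0 enum_valP.
Qed.

End SetCode.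

Lemma rank_of_covers r n (H : 'M['F_2]_(r, n)) R : covers H R -> \rank H = r.
Proof.
move=> covH; apply/eqP/row_freeP.
have colB i : exists x : 'cV['F_2]_n, H *m x = col i 1%:M.
  have [S [_ <-]] := covH (col i 1%:M); exists (\sum_(j in S) delta_mx j 0).
  by rewrite mulmx_sumr; apply: eq_bigr => j _; rewrite colE.
have [B BP] := fin_all_exists colB.
exists (\matrix_(j, i) B i j 0); apply/matrixP=> i k.
have /matrixP/(_ i 0) := BP k; rewrite !mxE => <-.
by apply: eq_bigr => j _; rewrite mxE.
Qed.

(** [A] is padded with nonzero vectors to exactly [n] columns. If cancellation leaves fewer than two
    of the four terms, their sum lies in [0 |: A] and [cov3] rewrites it with three columns. *)
Lemma code_of_set r n (A : {set 'cV['F_2]_r}) :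
  0 \notin A -> (#|A| <= n)%N -> (n.+1 ^ 3 < 2 ^ r)%N ->
  (forall v : 'cV['F_2]_r, exists s : seq 'cV['F_2]_r,
    [/\ size s = 4%N, {subset s <= 0 |: A} & \sum_(x <- s) x = v]) ->
  (forall v : 'cV['F_2]_r, v \in 0 |: A -> exists X : {set 'cV['F_2]_r},
    [/\ X \subset A, #|X| = 3%N & \sum_(x in X) x = v]) ->
  exists H : 'M['F_2]_(r, n), is_code_RL H 3 4 2.
Proof.
move=> A0 An n_lt cov4 cov3.
have A_sub : A \subset [set~ 0] by rewrite subsetC sub1set inE.
have n_le : (#|A| <= n <= #|[set~ 0%R : 'cV['F_2]_r]|)%N.
  rewrite An cardsC1 card_mx muln1 card_Fp // -ltnS prednK ?expn_gt0 //.
  by apply: leq_trans n_lt; rewrite ltnS (leq_trans (leqnSn n)) // -{1}[n.+1]expn1 leq_pexp2l.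
have [B [AB]] := superset_of_card A_sub n_le.
rewrite subsetC sub1set inE => B0 defn; subst n.
have cov24 v : exists S : {set 'I_#|B|}, (2 <= #|S| <= 4)%N /\ colsum (set_pcm B) S = v.
  have [X [XA /andP X24 <-]] : exists X : {set 'cV['F_2]_r},
    [/\ X \subset A, (2 <= #|X| <= 4)%N & \sum_(x in X) x = v].
    have [s [s4 sA <-]] := cov4 v; have [X [XA]] := set_sum_of_seq sA.
    rewrite s4 => X4 defX; have [X2|X1] := leqP 2 #|X|.
      by exists X; split=> //; apply/andP.
    have /cov3[Y [YA Y3 <-]] : \sum_(x <- s) x \in 0 |: A.
      move: X1; rewrite -defX leq_eqVlt => /predU1P[[]/eqP/cards1P[x Xx]|].
        by rewrite Xx big_set1 inE (subsetP XA) ?orbT // Xx set11.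
      by rewrite !ltnS leqn0 cards_eq0 => /eqP->; rewrite big_set0 !inE eqxx.
    by exists Y; rewrite Y3.
  have [S [defS <-]] := set_pcm_subset (subset_trans XA AB).
  by exists S; rewrite defS; split=> //; apply/andP.
have cov : covers (set_pcm B) 4.
  by move=> v; have [S [/andP[_ S4] <-]] := cov24 v; exists S.
exists (set_pcm B); split.
- exact: rank_of_covers cov.
- have [X [XA X3 sumX]] := cov3 0 (setU11 _ _).
  exact: (min_dist_set_pcm B0 (subset_trans XA AB) X3).
- by split=> // R'; apply: cov_radius_ge4.
(* In the partition into singletons, distinct columns automatically lie in distinct parts. *)
exists [set [set j] | j in [set: 'I_#|B|]]; split.
  apply/and3P; split.
  - apply/eqP/setP=> j; rewrite inE; apply/bigcupP; exists [set j]; rewrite ?set11 //.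
    exact: imset_f.
  - apply/trivIsetP=> _ _ /imsetP[i _ ->] /imsetP[j _ ->] ij.
    by rewrite disjoints1 inE; apply: contraNneq ij => ->.
  - by apply/imsetP=> -[j _ /setP/(_ j)]; rewrite !inE eqxx.
move=> v; have [S [S24 <-]] := cov24 v; exists S; split=> // _ /imsetP[j _ ->].
by apply: leq_trans (subset_leq_card (subsetIr _ _)) _; rewrite cards1.
Qed.

Lemma ell2_le r R n (H : 'M['F_2]_(r, n)) :
  \rank H = r -> cov_radius H R -> (ell2 r R <= n)%N.
Proof.
move=> rkH covH; rewrite /ell2.
case: ClassicalEpsilon.excluded_middle_informative => // exn; case: ex_minnP => k _; apply.
by rewrite /has_codeb; case: ClassicalEpsilon.excluded_middle_informative => // -[]; exists H.
Qed.

(** * Sums of four base points *)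

(* A trie represents a set of bit words of some fixed length not recorded in
   it: [Full] is the set of all words of the remaining length. *)
Inductive trie := Empty | Full | Node of trie & trie.

Fixpoint trie_mem (s : trie) (x : bitseq) : bool :=
  match s with
  | Empty => false
  | Full => true
  | Node l r => if x is b :: x' then trie_mem (if b then r else l) x' else false
  end.

(** Merging two full halves lets a set that has become everything be recognised by the single
    constructor [Full]. *)
Definition trie_node (l r : trie) : trie :=
  match l, r with
  | Empty, Empty => Empty
  | Full, Full => Full
  | _, _ => Node l r
  end.

Definition trie_child (b : bool) (s : trie) : trie :=
  if s is Node l r then if b then r else l else s.

Fixpoint trie_point (d : nat) : trie :=
  if d is d'.+1 then Node (trie_point d') Empty else Full.

Definition xor (x y : bitseq) : bitseq := [seq p.1 (+) p.2 | p <- zip x y].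

(* The union of [s] with the translate of [t] by [x]. *)
Fixpoint shift_union (x : bitseq) (s t : trie) : trie :=
  match t, s with
  | Empty, _ => s
  | _, Full => Full
  | _, _ =>
      if x is b :: x' then
        trie_node (shift_union x' (trie_child false s) (trie_child b t))
                  (shift_union x' (trie_child true s) (trie_child (~~ b) t))
      else if t is Full then Full else s
  end.

Lemma trie_mem_node l r b x :
  trie_mem (trie_node l r) (b :: x) = trie_mem (if b then r else l) x.
Proof. by case: b l r => [] [||? ?] [||? ?]. Qed.

Lemma trie_mem_child s b x : trie_mem s (b :: x) = trie_mem (trie_child b s) x.
Proof. by case: s. Qed.

Lemma shift_unionP x y s t : size y = size x ->
  trie_mem (shift_union x s t) y -> trie_mem s y || trie_mem t (xor x y).
Proof.
elim: x y s t => [|b x IHx] [|c y] s t //=.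
  by move=> _; case: t s => [||? ?] [||? ?] //= ->.
case=> yx; have step : trie_mem (trie_node
    (shift_union x (trie_child false s) (trie_child b t))
    (shift_union x (trie_child true s) (trie_child (~~ b) t))) (c :: y) ->
    trie_mem s (c :: y) || trie_mem t (xor (b :: x) (c :: y)).
  rewrite trie_mem_node /xor /= !trie_mem_child.
  by case: c => /(IHx _ _ _ yx); rewrite ?addbT ?addbF.
case: t step => [_ ->||t0 t1] //; first by rewrite orbT.
by case: s => // s0 s1 step /step.
Qed.

(** A sum of [k] terms either omits [x] or adds it to a sum of [k - 1] terms; the prepended [Empty]
    shifts the index and leaves nothing to add at [k = 0]. *)
Definition sums_step (x : bitseq) (c : seq trie) : seq trie :=
  mkseq (fun k => shift_union x (nth Empty c k) (nth Empty (Empty :: c) k)) (size c).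

(* Entry [i <= k] is the set of sums of [i]-element subsequences of [T]. *)
Definition subset_sums (d k : nat) (T : seq bitseq) : seq trie :=
  foldr sums_step (trie_point d :: nseq k Empty) T.

Lemma trie_mem_point d y : size y = d -> trie_mem (trie_point d) y -> y = nseq d false.
Proof. by elim: d y => [|d IHd] [|[] y] //= [] /IHd yd /yd->. Qed.

Lemma xorK x y : size y = size x -> xor x (xor x y) = y.
Proof.
rewrite /xor; elim: x y => [|b x IHx] [|c y] //= [] /IHx ->.
by rewrite addbA addbb.
Qed.

Lemma size_xor x y : size y = size x -> size (xor x y) = size x.
Proof. by move=> yx; rewrite size_map size1_zip ?yx. Qed.

(** Undoing the fold turns trie membership into a witness: if the word lies in the translated set,
    [x] is prepended and xored away. *)
Lemma subset_sumsP d k (T : seq bitseq) i y :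
    {in T, forall x, size x = d} -> size y = d ->
    trie_mem (nth Empty (subset_sums d k T) i) y ->
  exists s, [/\ subseq s T, size s = i & foldr xor (nseq d false) s = y].
Proof.
elim: T i y => [|x T IHT] i y Td yd /=.
  case: i => [/(trie_mem_point yd) ->|i]; first by exists [::].
  by rewrite /= nth_nseq if_same.
have xd : size x = d by apply: Td; apply: mem_head.
have {}Td : {in T, forall z, size z = d}.
  by move=> z zT; apply: Td; rewrite inE zT orbT.
rewrite -/(subset_sums d k T) /sums_step; set c := subset_sums d k T.
have [ic|ic] := ltnP i (size c); last by rewrite nth_default ?size_mkseq.
rewrite nth_mkseq // => /shift_unionP; rewrite yd xd => /(_ erefl) /orP[].
  move=> /(IHT _ _ Td yd)[s [sT si sy]]; exists s; split=> //.
  exact: subseq_trans sT (subseq_cons _ _).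
case: i {ic} => [//|i] /= /(IHT _ _ Td)[|s [sT si sy]].
  by rewrite size_xor xd.
exists (x :: s); rewrite /= eqxx si sy xorK ?xd //.
Qed.

(* Powers of a root [alpha] of [X^3 + X + 1], in the basis [1, alpha, alpha^2]
   of [F_8] over [F_2]. *)
Definition alpha_pow (k : nat) : bitseq :=
  nth [::] [:: [:: true; false; false]; [:: false; true; false];
               [:: false; false; true]; [:: true; true; false];
               [:: false; true; true]; [:: true; true; true];
               [:: true; false; true]] (k %% 7).

Definition zeros (n : nat) : bitseq := nseq n false.

(* In coordinates of [F_8^4]: the lines spanned by the first and by the third
   unit vector, and four multiples of the second one; found by computer search
   among sets invariant under a group of order 7. *)
Definition base_center : seq bitseq :=
  [:: zeros 12] ++
  [seq alpha_pow k ++ zeros 9 | k <- iota 0 7] ++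
  [seq zeros 6 ++ alpha_pow k ++ zeros 3 | k <- iota 0 7] ++
  [seq zeros 3 ++ alpha_pow k ++ zeros 6 | k <- [:: 0; 3; 4; 6]%N].

(* The line spanned by the point of the twisted cubic with parameter [alpha^j]
   for [j < 7], [0] for [j = 7], and infinity for [j = 8]. *)
Definition cubic_line (j : nat) : seq bitseq :=
  zeros 12 ::
  match j with
  | 7 => [seq alpha_pow k ++ zeros 9 | k <- iota 0 7]
  | 8 => [seq zeros 9 ++ alpha_pow k | k <- iota 0 7]
  | _ => [seq alpha_pow k ++ alpha_pow (k + j) ++ alpha_pow (k + 2 * j) ++
              alpha_pow (k + 3 * j) | k <- iota 0 7]
  end.

(** The matrix of eight unit vectors followed by the all-ones vector checks the repetition code of
    length 9. *)
Definition repetition_col (j : nat) : bitseq :=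
  if j == 8 then nseq 8 true else mkseq (eq_op j) 8.

Definition base_points : seq bitseq :=
  [seq zeros 8 ++ v | v <- base_center] ++
  [seq repetition_col j ++ v | j <- iota 0 9, v <- cubic_line j].

(** The computational core: the sums of four base points at distinct positions exhaust all words of
    length 20. *)
Lemma base_sums_full : nth Empty (subset_sums 20 4 base_points) 4 = Full.
Proof. by vm_compute. Qed.

Lemma size_base_points : size base_points = 91%N.
Proof. by []. Qed.

Lemma base_points_uniq : uniq base_points.
Proof. by vm_compute. Qed.

Lemma size_base_point x : x \in base_points -> size x = 20%N.
Proof.
by have /allP H : all (fun z => size z == 20) base_points by []; move/H/eqP.
Qed.

Lemma base_points0 : nseq 20 false \in base_points.
Proof. by vm_compute. Qed.

Definition row_of_bits (d : nat) (x : bitseq) : 'rV['F_2]_d :=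
  \row_i (nth false x i)%:R.

Lemma row_of_bits0 d : row_of_bits d (nseq d false) = 0.
Proof. by apply/rowP=> i; rewrite !mxE nth_nseq if_same. Qed.

Lemma row_of_bits_xor d x y : size x = d -> size y = d ->
  row_of_bits d (xor x y) = row_of_bits d x + row_of_bits d y.
Proof.
move=> xd yd; apply/rowP=> i; rewrite !mxE (nth_map (false, false)); last first.
  by rewrite size1_zip ?xd ?yd.
rewrite nth_zip ?xd ?yd //=.
by case: (nth _ x i) (nth _ y i) => [] []; apply: val_inj.
Qed.

Lemma size_xor_sum d (s : seq bitseq) : {in s, forall x, size x = d} ->
  size (foldr xor (nseq d false) s) = d.
Proof.
elim: s => [|x s IHs] /= sd; first by rewrite size_nseq.
have xd := sd x (mem_head _ _).
by rewrite size_xor xd // IHs // => z zs; apply: sd; rewrite inE zs orbT.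
Qed.

Lemma row_of_bits_sum d (s : seq bitseq) : {in s, forall x, size x = d} ->
  row_of_bits d (foldr xor (nseq d false) s) = \sum_(x <- s) row_of_bits d x.
Proof.
elim: s => [|x s IHs] sd; first by rewrite big_nil row_of_bits0.
have sd' : {in s, forall z, size z = d}.
  by move=> z zs; apply: sd; rewrite inE zs orbT.
rewrite big_cons -IHs //= row_of_bits_xor ?size_xor_sum //.
by apply: sd; apply: mem_head.
Qed.

Lemma base_cover (u : 'rV['F_2]_20) : exists s,
  [/\ subseq s base_points, size s = 4%N & \sum_(x <- s) row_of_bits 20 x = u].
Proof.
pose y := [seq u 0 i != 0 | i <- enum 'I_20].
have yd : size y = 20%N by rewrite size_map size_enum_ord.
have : trie_mem (nth Empty (subset_sums 20 4 base_points) 4) y.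
  by rewrite base_sums_full.
case/(subset_sumsP size_base_point yd) => s [sT s4 sy].
exists s; split=> //; rewrite -row_of_bits_sum; last first.
  by move=> x /(mem_subseq sT) /size_base_point.
rewrite sy; apply/rowP=> i; rewrite mxE (nth_map i) ?size_enum_ord //.
by rewrite nth_ord_enum -row_F2_neq0.
Qed.

(** * Lifting the base points *)

Lemma ex_notin (T : finType) (s : seq T) : (size s < #|T|)%N -> exists x, x \notin s.
Proof.
move=> sT; apply/existsP; apply: contraLR sT; rewrite negb_exists -leqNgt => /forallP sT.
rewrite cardT; apply: uniq_leq_size (enum_uniq _) _ => x _; exact/negPn/sT.
Qed.

(** The field of order [2 ^ m] is an [m]-dimensional space over F_2, and [f] takes coordinates in a
    basis. *)
Lemma char2_coordinates m : (0 < m)%N ->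
  exists (F : finFieldType) (f : F -> 'rV['F_2]_m),
    [/\ 2%N \in [pchar F], #|F| = (2 ^ m)%N, {morph f : x y / x + y} & bijective f].
Proof.
move=> m0; have [F F2 cardF] := pPrimePowerField (isT : prime 2) m0.
have := pprimeChar_vectAxiom F2; rewrite /= -[#|_|]/#|F| cardF pfactorK // => -[f f_lin f_bij].
exists F, f; split=> // x y.
by have := f_lin 1 x y; rewrite !scale1r.
Qed.

Lemma vandermonde_solve (F : fieldType) (b : seq F) (x : 'rV[F]_4) :
  uniq b -> size b = 4%N ->
  exists y : 'rV_4, forall i : 'I_4, \sum_(k < 4) y 0 k * b`_k ^+ i = x 0 i.
Proof.
move=> Ub b4; pose V := Vandermonde 4 (\row_(k < 4) b`_k).
have V_unit : V \in unitmx.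
  rewrite unitmxE unitfE det_Vandermonde; apply/prodf_neq0 => i _.
  apply/prodf_neq0 => j ij; rewrite !mxE subr_eq0 nth_uniq ?b4 //.
  by rewrite neq_ltn ij orbT.
exists (x *m invmx V^T) => i.
have /rowP/(_ i) : x *m invmx V^T *m V^T = x by rewrite mulmxKV ?unitmx_tr.
by rewrite mxE => <-; apply: eq_bigr => k _; rewrite !mxE.
Qed.

Section Lift.

Variables (m : nat) (F : finFieldType) (f : F -> 'rV['F_2]_m).
Hypotheses (F2 : 2%N \in [pchar F]) (fD : {morph f : x y / x + y}) (f_bij : bijective f).
Hypothesis F_gt : (91 <= #|F|)%N.

(** Base points get distinct nodes because [F] has at least 91 elements; the default 0 of [nth] is
    then never reached on them. *)
Definition cubic_node (p : bitseq) : F := nth 0 (enum F) (index p base_points).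

Lemma cubic_node_inj : {in base_points &, injective cubic_node}.
Proof.
move=> p q pT qT /eqP; rewrite nth_uniq ?enum_uniq -?cardE //.
- by move/eqP/(congr1 (nth [::] base_points)); rewrite !nth_index.
- by apply: leq_trans _ F_gt; rewrite -size_base_points index_mem.
- by apply: leq_trans _ F_gt; rewrite -size_base_points index_mem.
Qed.

Definition lift_col (u : 'rV['F_2]_20) (x : 'rV[F]_4) : 'cV['F_2]_(20 + 4 * m) :=
  col_mx u^T (mxvec (\matrix_(i, j) f (x 0 i) 0 j))^T.

Lemma lift_colD u u' x x' :
  lift_col (u + u') (x + x') = lift_col u x + lift_col u' x'.
Proof.
rewrite /lift_col add_col_mx; congr col_mx; first exact: linearD.
rewrite -linearD -[_ + mxvec _]linearD /=; congr (mxvec _)^T.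
by apply/matrixP=> i j; rewrite !mxE fD mxE.
Qed.

Lemma lift_col0 : lift_col 0 0 = 0.
Proof. by apply: (addrI (lift_col 0 0)); rewrite -lift_colD !addr0. Qed.

Lemma lift_col_sum (I : Type) (s : seq I) u x :
  lift_col (\sum_(i <- s) u i) (\sum_(i <- s) x i) = \sum_(i <- s) lift_col (u i) (x i).
Proof.
elim: s => [|i s IHs]; first by rewrite !big_nil lift_col0.
by rewrite !big_cons lift_colD IHs.
Qed.

Lemma lift_col_inj u u' x x' : lift_col u x = lift_col u' x' -> u = u' /\ x = x'.
Proof.
case/eq_col_mx => /trmx_inj -> /trmx_inj /(can_inj mxvecK) /matrixP eqx; split=> //.
apply/rowP=> i; apply: (bij_inj f_bij); apply/rowP=> j.
by have := eqx i j; rewrite !mxE.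
Qed.

Lemma lift_col_onto v : exists u x, v = lift_col u x.
Proof.
have [g fK gK] := f_bij.
exists (usubmx v)^T, (\row_i g (row i (vec_mx (dsubmx v)^T))).
rewrite /lift_col trmxK -[LHS]vsubmxK; congr col_mx; apply: trmx_inj.
rewrite trmxK -[LHS]vec_mxK; congr mxvec.
by apply/matrixP=> i j; rewrite !mxE gK !mxE.
Qed.

Definition lift_point (p : bitseq) (z : F) : 'cV['F_2]_(20 + 4 * m) :=
  lift_col (row_of_bits 20 p) (\row_i (z * cubic_node p ^+ i)).

(** Zero arises from the zero base point and must be removed, since a zero column would give a word
    of weight 1. *)
Definition lift_set : {set 'cV['F_2]_(20 + 4 * m)} :=
  [set v in [seq lift_point p z | p <- base_points, z <- enum F]] :\ 0.

Lemma lift_pointP v : reflect (exists p z, p \in base_points /\ v = lift_point p z)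
  (v \in 0 |: lift_set).
Proof.
have p0 : 0 = lift_point (nseq 20 false) 0.
  rewrite /lift_point row_of_bits0 -lift_col0; congr lift_col.
  by apply/rowP=> i; rewrite !mxE mul0r.
rewrite in_setU1 in_setD1 inE; have [->|_] := eqVneq v 0.
  by left; exists (nseq 20 false), 0; rewrite base_points0.
rewrite orFb andTb; apply: (iffP allpairsPdep).
  by move=> [p [z [pT _ ->]]]; exists p, z.
by move=> [p [z [pT ->]]]; exists p, z; rewrite mem_enum.
Qed.

Lemma card_lift_set : (#|lift_set| <= 91 * #|F|)%N.
Proof.
apply: leq_trans (subset_leq_card (subsetDl _ _)) _; rewrite cardsE.
by apply: leq_trans (card_size _) _; rewrite size_allpairs size_base_points -cardE.
Qed.

(** Four distinct base points handle the first 20 coordinates; their nodes are distinct, so a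
    Vandermonde system yields the four multipliers for the rest. *)
Lemma lift_cover4 (v : 'cV['F_2]_(20 + 4 * m)) : exists s : seq 'cV['F_2]_(20 + 4 * m),
  [/\ size s = 4%N, {subset s <= 0 |: lift_set} & \sum_(x <- s) x = v].
Proof.
have [u [x ->]] := lift_col_onto v.
have [s [sT s4 <-]] := base_cover u.
have Us : uniq [seq cubic_node p | p <- s].
  rewrite map_inj_in_uniq ?(subseq_uniq sT) ?base_points_uniq //.
  by move=> p q /(mem_subseq sT) pT /(mem_subseq sT) qT; apply: cubic_node_inj.
have [|y yP] := vandermonde_solve x Us; first by rewrite size_map.
pose e := [seq lift_point (nth [::] s k) (y 0 k) | k : 'I_4 <- enum 'I_4].
exists e; split; first by rewrite size_map size_enum_ord.
  move=> _ /mapP[k _ ->]; apply/lift_pointP; exists (nth [::] s k), (y 0 k).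
  by split=> //; apply: (mem_subseq sT); rewrite mem_nth ?s4.
rewrite big_map -lift_col_sum !big_enum /=; congr lift_col.
  by rewrite (big_nth [::]) s4 big_mkord.
apply/rowP=> i; rewrite summxE -yP; apply: eq_bigr => k _.
by rewrite mxE (nth_map [::]) ?s4.
Qed.

(** Over a fixed [p], three copies of the base point add up to one, so it suffices to write [z] as a
    sum of three distinct nonzero field elements. *)
Lemma lift_cover3 v : v \in 0 |: lift_set ->
  exists X : {set 'cV['F_2]_(20 + 4 * m)},
  [/\ X \subset lift_set, #|X| = 3%N & \sum_(x in X) x = v].
Proof.
move=> /lift_pointP[p [z [pT ->]]].
have add2 (x : F) : x + x = 0 by rewrite addrr_pchar2.
have inj : injective (lift_point p).
  move=> a b /lift_col_inj[_ /rowP/(_ 0)]; rewrite !mxE expr0 !mulr1; exact.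
have mem a : a != 0 -> lift_point p a \in lift_set.
  move=> a0; have : lift_point p a \in 0 |: lift_set by apply/lift_pointP; exists p, a.
  rewrite inE => /orP[|//]; rewrite inE -lift_col0 => /eqP/lift_col_inj[_ /rowP/(_ 0)].
  by rewrite !mxE expr0 mulr1 => a00; rewrite a00 eqxx in a0.
(* With [c = z + a + b], the exclusions [a != z], [b != z] and [b != z + a] give [b != c], [a != c]
   and [c != 0]. *)
have [|a] := @ex_notin F [:: 0; z]; first exact: leq_trans F_gt.
rewrite !inE negb_or => /andP[a0 az].
have [|b] := @ex_notin F [:: 0; z; a; z + a]; first exact: leq_trans F_gt.
rewrite !inE !negb_or => /and4P[b0 bz ba bza].
have eq2 (x y : F) : (x == y) = (x + y == 0) by rewrite addr_eq0 oppr_pchar2.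
pose c := z + a + b.
have ac : a != c by rewrite eq_sym eq2 /c addrAC -(addrA z) add2 addr0 addrC -eq2.
have bc : b != c by rewrite eq_sym eq2 /c -addrA add2 addr0 addrC -eq2.
have c0 : c != 0 by rewrite /c addrC -eq2.
exists (lift_point p @: (a |: [set b; c])); split.
- by apply/subsetP=> _ /imsetP[x /setU1P[->|/set2P[]->] ->]; apply: mem.
- by rewrite card_imset // cardsU1 cards2 bc !inE negb_or eq_sym ba ac.
rewrite big_imset /=; last by move=> ? ? _ _; apply: inj.
rewrite big_setU1 ?inE ?negb_or 1?eq_sym ?ba //= big_setU1 ?inE //= big_set1.
rewrite /lift_point -!lift_colD addmx2 addr0; congr lift_col.
apply/rowP=> i; rewrite !mxE -!mulrDl; congr (_ * _).
by rewrite addrA /c -(addrA z a) [LHS]addrCA add2 addr0.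
Qed.

End Lift.

(* Choice of the field and length for codimension [4 * t] *)
Local Close Scope ring_scope.

Theorem theorem9p4 (t : nat) : (12 <= t)%N ->
  (exists H : 'M['F_2]_(4 * t, 2944 * 2 ^ (t - 10) - 3),
      is_code_RL H 3 4 2) /\
  (ell2 (4 * t) 4 <= 2944 * 2 ^ (t - 10) - 3)%N.
Proof.
move=> t12; suff [H codeH] : exists H : 'M['F_2]_(4 * t, 2944 * 2 ^ (t - 10) - 3),
    is_code_RL H 3 4 2.
  by split; [exists H | case: codeH => rkH _ covH _; apply: ell2_le covH].
pose m := (t - 5)%N; have m0 : (0 < m)%N by rewrite subn_gt0; lia.
have q128 : (128 <= 2 ^ m)%N by rewrite -[128%N]/(2 ^ 7)%N leq_exp2l // /m; lia.
(* Here [2944 = 92 * 2 ^ 5]. *)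
have -> : (2944 * 2 ^ (t - 10) = 92 * 2 ^ m)%N.
  rewrite (_ : m = 5 + (t - 10))%N; last by rewrite /m; lia.
  by rewrite expnD mulnA.
have -> : (4 * t = 20 + 4 * m)%N by rewrite /m; lia.
have [F [f [F2 cardF fD f_bij]]] := char2_coordinates m0.
have F91 : (91 <= #|F|)%N by rewrite cardF; lia.
apply: (@code_of_set _ _ (lift_set f)).
- by rewrite !inE eqxx.
- by apply: leq_trans (card_lift_set _) _; rewrite cardF; lia.
(* Since [92 < 2 ^ 7], the counting bound follows from [3 * (7 + m) < 20 + 4 * m]. *)
- have lt_n : ((92 * 2 ^ m - 3).+1 <= 2 ^ (7 + m))%N by rewrite expnD; lia.
  apply: (@leq_ltn_trans ((2 ^ (7 + m)) ^ 3)%N); first by rewrite leq_exp2r.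
  by rewrite -expnM ltn_exp2l // /m; lia.
- exact: lift_cover4.
- exact: lift_cover3.
Qed.
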